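(* Let $\Omega\subset\mathbb R^n$ be a bounded domain and let $I$ be a nonlocal operator on $\Omega$ having the five properties Continuity, Stability, Monotonicity, Invariance and Degenerate ellipticity listed in the context. Let $\underline u,\bar u:\mathbb R^n\to\mathbb R$ be bounded continuous functions which are respectively a viscosity subsolution and a viscosity supersolution of $I=0$ in $\Omega$. Assume moreover that $\bar u=\underline u=g$ in $\Omega^c$ for some bounded continuous function $g$, and that $\underline u\le\bar u$ in $\mathbb R^n$. Let $$\mathcal F=\{u\in C^0(\mathbb R^n):\ \underline u\le u\le\bar u\ \text{in }\mathbb R^n\ \text{and } u \text{ is a viscosity subsolution of } I=0 \text{ in }\Omega\}.$$ Then $w(x)=\sup_{u\in\mathcal F}u(x)$, $x\in\mathbb R^n$, is a discontinuous viscosity solution of the Dirichlet problem $$I(x,u(x),u(\cdot))=0\ \text{ in }\Omega,\qquad u=g\ \text{ in }\Omega^c.$$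
   Context: $B_\delta(x)$ is the open ball of radius $\delta$ centered at $x$. For open $U$, $C^2(U)$ denotes $C^{1,1}(U)$, the functions whose first partial derivatives are locally Lipschitz in $U$ (convention: $C^\beta=C^{r,\beta-r}$ with $r$ the largest integer smaller than $\beta$); $C_b^2(\mathbb R^n)$ is the set of bounded functions in $C^2(\mathbb R^n)$. $USC(\mathbb R^n)$, $LSC(\mathbb R^n)$ denote upper/lower semicontinuous functions. A nonlocal operator $I$ on $\Omega$ assigns a real number $I(x,r,\varphi(\cdot))$ to each $x\in\Omega$, $r\in\mathbb R$ and $\varphi\in C^2(B_\delta(x))\cap L^\infty(\mathbb R^n)$ (any $\delta>0$). Properties (for all $\delta>0$, $r,s\in\mathbb R$, $x,x_k\in\Omega$, $\varphi,\varphi_k,\psi\in C^2(B_\delta(x))\cap L^\infty(\mathbb R^n)$): - Continuity: $(y,r)\mapsto I(y,r,\varphi(\cdot))$ is continuous on $(B_\delta(x)\cap\Omega)\times\mathbb R$. - Stability: if $x_k\to x$ in $\Omega$, $\varphi_k\to\varphi$ a.e. in $\mathbb R^n$, $\varphi_k\to\varphi$ in $C^2(B_\delta(x))$ and $\{\varphi_k\}$ is uniformly bounded in $\mathbb R^n$, then $I(x_k,r,\varphi_k(\cdot))\to I(x,r,\varphi(\cdot))$. - Monotonicity: if $r\le s$ then $I(x,r,\varphi(\cdot))\le I(x,s,\varphi(\cdot))$. - Invariance: $I(x,r,\varphi(\cdot)+C)=I(x,r,\varphi(\cdot))$ for every constant $C$. - Degenerate ellipticity: if $\varphi$ touches $\psi$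 from above at $x$ (i.e. $\varphi\ge\psi$ in $\mathbb R^n$, $\varphi(x)=\psi(x)$), then $I(x,r,\varphi(\cdot))\le I(x,r,\psi(\cdot))$. A bounded $u\in USC(\mathbb R^n)$ is a viscosity subsolution of $I=0$ in $\Omega$ if whenever $u-\varphi$ has a maximum over $\mathbb R^n$ at $x\in\Omega$ for some $\varphi\in C_b^2(\mathbb R^n)$, then $I(x,u(x),\varphi(\cdot))\le0$. A bounded $u\in LSC(\mathbb R^n)$ is a viscosity supersolution of $I=0$ in $\Omega$ if whenever $u-\varphi$ has a minimum over $\mathbb R^n$ at $x\in\Omega$ for some $\varphi\in C_b^2(\mathbb R^n)$, then $I(x,u(x),\varphi(\cdot))\ge0$. $u$ is a viscosity subsolution (supersolution) of the Dirichlet problem if it is a viscosity subsolution (supersolution) of $I=0$ in $\Omega$ and $u\le g$ ($u\ge g$) in $\Omega^c$. For a bounded $u:\mathbb R^n\to\mathbb R$, $u^*(x)=\lim_{r\to0}\sup\{u(y):|y-x|\le r\}$ and $u_*(x)=\lim_{r\to0}\inf\{u(y):|y-x|\le r\}$. A bounded function $u$ is a discontinuous viscosity solution of the Dirichlet problem if $u^*$ is a viscosity subsolution and $u_*$ is a viscosity supersolution of the Dirichlet problem. *)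

(* Defs.v *)
From mathcomp Require Import all_boot all_order all_algebra.
From mathcomp Require Import all_classical all_reals all_analysis.

Set Implicit Arguments.
Unset Strict Implicit.
Unset Printing Implicit Defensive.

Import Order.TTheory GRing.Theory Num.Theory.
Import numFieldNormedType.Exports.

Local Open Scope classical_set_scope.
Local Open Scope ring_scope.

(* R^n is ['rV[R]_n]. The library equips it with the sup norm; the topology,   *)
(* bounded sets, differentiability and Lipschitz functions are the usual       *)
(* ones, but the library balls are cubes, so round balls are defined here.     *)
Section euclidean.
Context {R : realType} {n : nat}.
Implicit Types (x y a b : 'rV[R]_n).

Definition enorm x : R := Num.sqrt (\sum_(i < n) x ord0 i ^+ 2).

Definition eball x (d : R) : set 'rV[R]_n := [set y | enorm (y - x) < d].

Definition closed_eball x (d : R) : set 'rV[R]_n :=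
  [set y | enorm (y - x) <= d].

Definition is_domain (Omega : set 'rV[R]_n) : Prop :=
  [/\ open Omega, connected Omega & Omega !=set0].

End euclidean.

Section lebesgue.
Context {R : realType} {n : nat}.
Implicit Types (a b : 'rV[R]_n).

Definition box a b : set 'rV[R]_n :=
  [set x | forall i, a ord0 i <= x ord0 i <= b ord0 i].

Definition box_volume a b : R := \prod_(i < n) (b ord0 i - a ord0 i).

Definition lebesgue_null (N : set 'rV[R]_n) : Prop :=
  forall e : R, 0 < e -> exists a b : nat -> 'rV[R]_n,
    [/\ forall k i, a k ord0 i <= b k ord0 i,
        N `<=` \bigcup_k box (a k) (b k)
      & (\sum_(0 <= k <oo) (box_volume (a k) (b k))%:E <= e%:E)%E].

Definition ae_lebesgue (P : 'rV[R]_n -> Prop) : Prop :=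
  lebesgue_null [set x | ~ P x].

(* The Lebesgue sigma-algebra, as the completion of the Borel one. *)
Definition lebesgue_measurable (A : set 'rV[R]_n) : Prop :=
  exists2 B : set 'rV[R]_n, <<s @open 'rV[R]_n >> B &
    lebesgue_null ((A `\` B) `|` (B `\` A)).

Definition Linfty (phi : 'rV[R]_n -> R) : Prop :=
  (forall c : R, lebesgue_measurable [set x | c < phi x]) /\
  (exists M : R, ae_lebesgue (fun x => `|phi x| <= M)).

End lebesgue.

Section regularity.
Context {R : realType} {n : nat}.
Implicit Types (U : set 'rV[R]_n) (phi u : 'rV[R]_n -> R) (x y : 'rV[R]_n).

Definition partial (i : 'I_n) phi : 'rV[R]_n -> R :=
  fun x => 'D_(delta_mx ord0 i) phi x.

Definition locally_lipschitz U (f : 'rV[R]_n -> R) : Prop :=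
  forall x, U x -> exists2 V, nbhs x V & [lipschitz f y | y in V].

(* C^2 means C^{1,1}_loc here: second derivatives need not exist. *)
Definition C2 U phi : Prop :=
  (forall x, U x -> differentiable phi x) /\
  (forall i, locally_lipschitz U (partial i phi)).

Definition Cb2 phi : Prop := C2 setT phi /\ bounded_fun phi.

(* Convergence in the C^{1,1}(U) norm: uniform convergence of the functions    *)
(* and of their first partial derivatives, and convergence to 0 of the         *)
(* Lipschitz seminorms on U of the partial derivatives of the differences.     *)
Definition cvgC2 U (phi_ : nat -> 'rV[R]_n -> R) phi : Prop :=
  forall e : R, 0 < e -> \forall k \near \oo,
    (forall y, U y -> `|phi_ k y - phi y| <= e) /\
    (forall i : 'I_n,
      let d y := partial i (phi_ k) y - partial i phi y in
      (forall y, U y -> `|d y| <= e) /\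
      (forall y z, U y -> U z -> `|d y - d z| <= e * enorm (y - z))).

Definition LSC u : Prop := lower_semicontinuous (fun x => (u x)%:E).

Definition USC u : Prop :=
  forall x (a : R), u x < a -> \forall y \near x, u y < a.

Definition usc_envelope u : 'rV[R]_n -> R :=
  fun x => lim (sup [set u y | y in closed_eball x r] @[r --> 0^'+]).

Definition lsc_envelope u : 'rV[R]_n -> R :=
  fun x => lim (inf [set u y | y in closed_eball x r] @[r --> 0^'+]).

End regularity.

(* A nonlocal operator is a total function; its values are meaningful, and     *)
(* constrained below, only at x in Omega and at phi that are C^2 in a ball     *)
(* around x and in L^infty(R^n).                                               *)
Definition nonlocal_operator (R : realType) (n : nat) : Type :=
  'rV[R]_n -> R -> ('rV[R]_n -> R) -> R.

Section operator.
Context {R : realType} {n : nat}.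
Variables (Omega : set 'rV[R]_n) (I : nonlocal_operator R n).
Implicit Types (x : 'rV[R]_n) (r s d : R) (phi psi : 'rV[R]_n -> R).

Definition admissible x d phi : Prop := C2 (eball x d) phi /\ Linfty phi.

Definition op_continuity : Prop :=
  forall d x phi, 0 < d -> Omega x -> admissible x d phi ->
  {within (eball x d `&` Omega) `*` [set: R],
    continuous (fun yr : 'rV[R]_n * R => I yr.1 yr.2 phi)}.

Definition op_stability : Prop :=
  forall d r x (x_ : nat -> 'rV[R]_n) phi (phi_ : nat -> 'rV[R]_n -> R),
  0 < d -> Omega x -> (forall k, Omega (x_ k)) ->
  admissible x d phi -> (forall k, admissible x d (phi_ k)) ->
  x_ @ \oo --> x ->
  ae_lebesgue (fun y => phi_ k y @[k --> \oo] --> phi y) ->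
  cvgC2 (eball x d) phi_ phi ->
  (exists M : R, forall k y, `|phi_ k y| <= M) ->
  I (x_ k) r (phi_ k) @[k --> \oo] --> I x r phi.

Definition op_monotonicity : Prop :=
  forall d r s x phi, 0 < d -> Omega x -> admissible x d phi ->
  r <= s -> I x r phi <= I x s phi.

Definition op_invariance : Prop :=
  forall d r x phi (C : R), 0 < d -> Omega x -> admissible x d phi ->
  I x r (fun y => phi y + C) = I x r phi.

Definition op_degenerate_ellipticity : Prop :=
  forall d r x phi psi, 0 < d -> Omega x ->
  admissible x d phi -> admissible x d psi ->
  (forall y, psi y <= phi y) -> phi x = psi x ->
  I x r phi <= I x r psi.

Definition viscosity_subsolution (u : 'rV[R]_n -> R) : Prop :=
  [/\ bounded_fun u, USC u &
    forall phi x, Cb2 phi -> Omega x ->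
      (forall y, u y - phi y <= u x - phi x) -> I x (u x) phi <= 0].

Definition viscosity_supersolution (u : 'rV[R]_n -> R) : Prop :=
  [/\ bounded_fun u, LSC u &
    forall phi x, Cb2 phi -> Omega x ->
      (forall y, u x - phi x <= u y - phi y) -> 0 <= I x (u x) phi].

Definition dirichlet_subsolution (g u : 'rV[R]_n -> R) : Prop :=
  viscosity_subsolution u /\ (forall x, ~ Omega x -> u x <= g x).

Definition dirichlet_supersolution (g u : 'rV[R]_n -> R) : Prop :=
  viscosity_supersolution u /\ (forall x, ~ Omega x -> g x <= u x).

Definition discontinuous_viscosity_solution (g u : 'rV[R]_n -> R) : Prop :=
  [/\ bounded_fun u,
      dirichlet_subsolution g (usc_envelope u) &
      dirichlet_supersolution g (lsc_envelope u)].

Definition perron_family (ul ub : 'rV[R]_n -> R) : set ('rV[R]_n -> R) :=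
  [set u | [/\ continuous u, (forall x, ul x <= u x <= ub x) &
    viscosity_subsolution u]].

Definition perron_sup (ul ub : 'rV[R]_n -> R) : 'rV[R]_n -> R :=
  fun x => sup [set u x | u in perron_family ul ub].

End operator.

(* Main.v *)
(* Perron's method. Both halves perturb a test function phi touching at x by a
   small multiple of the penalty sum_i h (y_i - x_i), h t = t^2 / (1 + t^2);
   Stability and Continuity keep the sign of I for the perturbed function near x.

   If I were positive at a maximum x of w^* - phi, a member u of the family with
   u (x') close to w^* x would be such that u - (phi + e * penalty) has a global
   maximum near x, contradicting that u is a subsolution.

   The supremum w is lower semicontinuous, so w_* = w. Suppose I is negative at a
   minimum x of w - phi. Then w x < ub x, since ub is a supersolution. By
   compactness one (continuous) member u of the family exceeds
   phi + w x - phi x - eta everywhere, and the maximum of u and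
   phi + w x - phi x - e * penalty + kappa is again in the family, by degenerate
   ellipticity, but it is larger than w at x. *)
Require Import Defs.
From mathcomp Require Import all_boot all_order all_algebra.
From mathcomp Require Import all_classical all_reals all_analysis.
From mathcomp Require Import ring lra.
Set Implicit Arguments.
Unset Strict Implicit.
Import Order.TTheory GRing.Theory Num.Theory.
Import numFieldNormedType.Exports.
Local Open Scope classical_set_scope.
Local Open Scope ring_scope.

(** * The one-variable function h t = 1 - 1 / (1 + t^2) and its derivative *)

Lemma rational_bump_lip (R : realType) (s t : R) :
  `|2 * s / (1 + s ^+ 2) ^+ 2 - 2 * t / (1 + t ^+ 2) ^+ 2| <= 2 * `|s - t|.
Proof.
have ps : 0 < 1 + s ^+ 2 by rewrite ltr_pwDl // sqr_ge0.
have pt : 0 < 1 + t ^+ 2 by rewrite ltr_pwDl // sqr_ge0.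
have -> : 2 * s / (1 + s ^+ 2) ^+ 2 - 2 * t / (1 + t ^+ 2) ^+ 2 =
  (2 * (s * (1 + t ^+ 2) ^+ 2 - t * (1 + s ^+ 2) ^+ 2)) / ((1 + s ^+ 2) * (1 + t ^+ 2))^+2.
  by field; rewrite !lt0r_neq0.
have p2 : 0 < ((1 + s ^+ 2) * (1 + t ^+ 2))^+2 by rewrite exprn_gt0 // mulr_gt0.
rewrite normrM [X in _ * X]gtr0_norm ?invr_gt0 // ler_pdivrMr //.
have -> : 2 * (s * (1 + t ^+ 2) ^+ 2 - t * (1 + s ^+ 2) ^+ 2) =
  (s - t) * (2 * (1 - s * t * (2 + s ^+ 2 + s * t + t ^+ 2))).
  by ring.
rewrite normrM [X in _ <= X]mulrAC [X in X <= _]mulrC ler_wpM2r // normrM ger0_norm //.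
rewrite ler_pM2l //.
have s0 := sqr_ge0 s; have t0 := sqr_ge0 t; have st0 := mulr_ge0 s0 t0.
have d0 := sqr_ge0 (s - t); have e0 := sqr_ge0 (s + t).
(* With a = s^2 + t^2 and |s t| <= a / 2, the factor left besides s - t is at most 1 + a + 3 a^2 / 4
   <= (1 + a)^2 in absolute value, which the denominator dominates. *)
have a1 : (1 + (s ^+ 2 + t ^+ 2)) ^+ 2 <= ((1 + s ^+ 2) * (1 + t ^+ 2))^+2.
  by rewrite ler_pXn2r // ?nnegrE; nra.
apply: le_trans a1; rewrite ler_norml; apply/andP; split; nra.
Qed.

Lemma rational_bump_deriv_le1 (R : realType) (t : R) :
  `|2 * t / (1 + t ^+ 2) ^+ 2| <= 1.
Proof.
have t0 := sqr_ge0 t; have p0 := sqr_ge0 (1 + t); have m0 := sqr_ge0 (1 - t).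
have pt : 0 < (1 + t ^+ 2) ^+ 2 by rewrite exprn_gt0 // ltr_pwDl.
rewrite normrM [X in _ * X]gtr0_norm ?invr_gt0 // ler_pdivrMr // mul1r.
by rewrite ler_norml; apply/andP; split; nra.
Qed.

Lemma is_derive_rational_bump (R : realType) (t : R) :
  is_derive t 1 (fun s : R => 1 - (1 + s ^+ 2)^-1) (2 * t / (1 + t ^+ 2) ^+ 2).
Proof.
have pt : 1 + t ^+ 2 != 0 by rewrite lt0r_neq0 // ltr_pwDl // sqr_ge0.
have D : is_derive t 1 (fun s : R => 1 + s ^+ 2) (2 * t).
  by apply: is_derive_eq; rewrite /GRing.scale /=; ring.
have D2 := @is_deriveV _ (fun s : R => 1 + s ^+ 2) _ _ _ pt D.
by apply: is_derive_eq; rewrite /GRing.scale /=; field.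
Qed.

(** * The penalty: a bounded substitute for the squared distance *)

Section penalty.
Context {R : realType} {n : nat}.
Implicit Types x y : 'rV[R]_n.

(** Like the squared distance it vanishes only at [x], but it is bounded with bounded, Lipschitz
    first derivatives, so adding multiples of it to a test function gives a test function on the
    whole space. *)
Definition penalty x y : R :=
  \sum_(i < n) (1 - (1 + (y ord0 i - x ord0 i) ^+ 2)^-1).

Lemma penalty_self x : penalty x x = 0.
Proof. by rewrite /penalty big1 // => i _; rewrite subrr expr0n addr0 invr1 subrr. Qed.

Lemma rational_bump_itv (t : R) : 0 <= 1 - (1 + t ^+ 2)^-1 <= 1.
Proof.
have p : 0 < 1 + t ^+ 2 by rewrite ltr_pwDl // sqr_ge0.
rewrite subr_ge0 invf_le1 // lerDl sqr_ge0 /=.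
by rewrite gerBl invr_ge0 ltW.
Qed.

Lemma penalty_ge0 x y : 0 <= penalty x y.
Proof. by apply: sumr_ge0 => i _; case/andP: (rational_bump_itv (y ord0 i - x ord0 i)). Qed.

Lemma penalty_le x y : penalty x y <= n%:R.
Proof.
rewrite -[n in n%:R]card_ord -sumr_const.
by apply: ler_sum => i _; case/andP: (rational_bump_itv (y ord0 i - x ord0 i)).
Qed.

(** The sup norm is attained at some coordinate; its term alone gives the bound, since h is
    increasing in |t| and the other terms are nonnegative. *)
Lemma le_penalty x y (r : R) : 0 < r -> r <= `|y - x| ->
  1 - (1 + r ^+ 2)^-1 <= penalty x y.
Proof.
move=> r0 ry.
have : mx_norm (y - x) != 0 by rewrite lt0r_neq0 // (lt_le_trans r0).
move=> /mx_norm_neq0 [[j i] /= yx]; rewrite ord1 !mxE in yx.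
have {}ry : r <= `|y ord0 i - x ord0 i| by rewrite -yx.
rewrite /penalty (bigD1 i) //= -[X in X <= _]addr0 lerD //; last first.
  by apply: sumr_ge0 => k _; case/andP: (rational_bump_itv (y ord0 k - x ord0 k)).
rewrite lerD2l lerN2 lef_pV2 ?posrE ?ltr_pwDl ?sqr_ge0 // lerD2l.
rewrite -[X in _ <= X]real_normK ?num_real //.
by rewrite ler_pXn2r // nnegrE ltW.
Qed.

Lemma differentiable_rational_bump x y i :
  differentiable (fun z : 'rV[R]_n => 1 - (1 + (z ord0 i - x ord0 i) ^+ 2)^-1 : R) y.
Proof.
have d1 : differentiable (fun z : 'rV[R]_n => z ord0 i - x ord0 i : R) y.
  apply: differentiableB; [exact: differentiable_coord|exact: differentiable_cst].
apply: (@differentiable_comp _ _ _ _ (fun z : 'rV[R]_n => z ord0 i - x ord0 i : R)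
  (fun s : R => 1 - (1 + s ^+ 2)^-1)) => //.
apply/derivable1_diffP.
by case: (@is_derive_rational_bump R (y ord0 i - x ord0 i)).
Qed.

(** Equal increments give equal difference quotients, so a partial derivative on row vectors reduces
    to a one-variable derivative without a chain rule. *)
Lemma eq_derive_quotient (V W : normedModType R) (f : V -> R) (g : W -> R)
    (a v : V) (b w : W) :
  (forall h : R, f (h *: v + a) - f a = g (h *: w + b) - g b) ->
  'D_v f a = 'D_w g b.
Proof.
move=> fg; rewrite /derive; set F := (F in lim (F @ _)); set G := (G in _ = lim (G @ _)).
by have -> : F = G by apply/funext => h; rewrite /F /G /= fg.
Qed.

Lemma derive_rational_bump x y i j :
  partial i (fun z : 'rV[R]_n => 1 - (1 + (z ord0 j - x ord0 j) ^+ 2)^-1) y =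
  (i == j)%:R * (2 * (y ord0 i - x ord0 i) / (1 + (y ord0 i - x ord0 i) ^+ 2) ^+ 2).
Proof.
have [_ DH] := @is_derive_rational_bump R (y ord0 i - x ord0 i).
case: eqVneq => [<-|ij]; last first.
  (* Along a direction [i] other than [j] the function is constant, so it is compared with a
     constant on the line. *)
  rewrite mul0r -(@derive_cst R R R (1 - (1 + (y ord0 j - x ord0 j) ^+ 2)^-1) 0 1).
  apply: eq_derive_quotient => h.
  by rewrite !mxE (eq_sym j) (negbTE ij) mulr0 add0r.
rewrite mul1r -DH; apply: eq_derive_quotient => h.
by rewrite !mxE !eqxx /= [h *: 1]mulr1 mulr1 addrA.
Qed.

Lemma penaltyE x : penalty x =
  \sum_(i < n) (fun y : 'rV[R]_n => 1 - (1 + (y ord0 i - x ord0 i) ^+ 2)^-1).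
Proof. by rewrite fct_sumE. Qed.

Lemma differentiable_penalty x y : differentiable (penalty x) y.
Proof.
rewrite penaltyE; apply: differentiable_sum => i.
exact: differentiable_rational_bump.
Qed.

Lemma partial_penalty x y i : partial i (penalty x) y =
  2 * (y ord0 i - x ord0 i) / (1 + (y ord0 i - x ord0 i) ^+ 2) ^+ 2.
Proof.
rewrite /partial penaltyE derive_sum => [|j]; last first.
  exact/diff_derivable/differentiable_rational_bump.
rewrite (bigD1 i) //= [X in X + _]derive_rational_bump eqxx mul1r big1 ?addr0 // => j ji.
by rewrite [LHS]derive_rational_bump eq_sym (negbTE ji) mul0r.
Qed.

Lemma partial_penalty_le1 x y i : `|partial i (penalty x) y| <= 1.
Proof. by rewrite partial_penalty rational_bump_deriv_le1. Qed.

Lemma le_coord_norm x i : `|x ord0 i| <= `|x|.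
Proof.
rewrite [in leRHS]/Num.Def.normr/= mx_normrE.
exact: (le_bigmax _ (fun ij : 'I_1 * 'I_n => `|x ij.1 ij.2|) (ord0, i)).
Qed.

(** The bound involves one coordinate only, so it serves both the sup norm of [C2] and the Euclidean
    norm of [cvgC2]. *)
Lemma partial_penalty_lip x y z i :
  `|partial i (penalty x) y - partial i (penalty x) z| <= 2 * `|y ord0 i - z ord0 i|.
Proof.
rewrite !partial_penalty.
have -> : y ord0 i - z ord0 i = (y ord0 i - x ord0 i) - (z ord0 i - x ord0 i).
  by rewrite opprB addrA subrK.
exact: rational_bump_lip.
Qed.

Lemma le_coord_enorm x i : `|x ord0 i| <= enorm x.
Proof.
rewrite -sqrtr_sqr ler_wsqrtr // (bigD1 i) //= lerDl.
by apply: sumr_ge0 => j _; rewrite sqr_ge0.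
Qed.

Lemma enorm_lt (d : R) : 0 < d -> exists2 e : R, 0 < e & forall x, `|x| < e -> enorm x < d.
Proof.
(* The sum of squares is at most n (d / (n + 1))^2, and n < (n + 1)^2. *)
move=> d0; exists (d / n.+1%:R); first by rewrite divr_gt0.
move=> x xe; rewrite -[ltRHS]gtr0_norm // -sqrtr_sqr ltr_sqrt ?exprn_gt0 //.
apply: (@le_lt_trans _ _ (\sum_(i < n) (d / n.+1%:R) ^+ 2)).
  apply: ler_sum => i _; rewrite -real_normK ?num_real //.
  rewrite ler_pXn2r ?nnegrE ?divr_ge0 ?(ltW d0) //.
  exact: le_trans (le_coord_norm _ _) (ltW xe).
rewrite sumr_const card_ord -[ltLHS]mulr_natl expr_div_n mulrA ltr_pdivrMr ?exprn_gt0 //.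
rewrite mulrC ltr_pM2l ?exprn_gt0 // -natrX ltr_nat.
by rewrite -mulnn mulSn ltnS leq_addr.
Qed.
End penalty.

(** * Boundedness and Lipschitz continuity through a single constant *)

Section bounded.
Context {R : realType}.

Lemma bounded_fun_exP (T : Type) (f : T -> R) :
  bounded_fun f <-> exists M : R, forall x, `|f x| <= M.
Proof.
split=> [/pinfty_ex_gt0[M _ fM]|[M fM]]; first by exists M => x; exact: fM.
exists M; split; first exact: num_real.
by move=> N /ltW MN x _; exact: le_trans (fM x) MN.
Qed.

Lemma lipschitz_exP (V : normedModType R) (f : V -> R) (A : set V) :
  [lipschitz f x | x in A] <->
  exists M : R, forall x y, A x -> A y -> `|f x - f y| <= M * `|x - y|.
Proof.
split=> [/pinfty_ex_gt0[M _ fM]|[M fM]].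
  by exists M => x y Ax Ay; exact: (fM (x, y)).
exists M; split; first exact: num_real.
move=> N /ltW MN [x y] [/= Ax Ay]; apply: le_trans (fM _ _ Ax Ay) _.
by rewrite ler_wpM2r.
Qed.

End bounded.

(** * Test functions: closure properties and admissibility *)

Section C2.
Context {R : realType} {n : nat}.
Implicit Types (phi psi : 'rV[R]_n -> R) (x y : 'rV[R]_n) (U : set 'rV[R]_n).

Lemma partialDZ phi psi (t : R) i y :
  differentiable phi y -> differentiable psi y ->
  partial i (fun z => phi z + t * psi z) y =
  partial i phi y + t * partial i psi y.
Proof.
move=> dphi dpsi; rewrite /partial.
have -> : (fun z => phi z + t * psi z) = phi + t *: psi by [].
by rewrite deriveD ?deriveZ //; [exact: diff_derivable..|exact/diff_derivable/differentiableZ].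
Qed.

Lemma C2DZ phi psi (t : R) : C2 setT phi -> C2 setT psi ->
  C2 setT (fun z => phi z + t * psi z).
Proof.
move=> [d1 l1] [d2 l2]; split=> [x _|i x _].
  by apply: differentiableD; [exact: d1|apply: differentiableZ; exact: d2].
have [V1 V1x /lipschitz_exP[M1 L1]] := l1 i x I.
have [V2 V2x /lipschitz_exP[M2 L2]] := l2 i x I.
exists (V1 `&` V2); first exact: filterI.
apply/lipschitz_exP; exists (M1 + `|t| * M2) => y z [y1 y2] [z1 z2].
rewrite !partialDZ; [|exact: d1|exact: d2|exact: d1|exact: d2].
rewrite opprD addrACA -mulrBr (le_trans (ler_normD _ _)) // mulrDl lerD ?L1 //.
by rewrite normrM -mulrA ler_wpM2l ?L2.
Qed.

Lemma C2_setT U phi : C2 setT phi -> C2 U phi.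
Proof. by move=> [d l]; split=> [x _|i x _]; [exact: d|exact: l]. Qed.

Lemma Cb2DZ phi psi (t : R) : Cb2 phi -> Cb2 psi -> Cb2 (fun z => phi z + t * psi z).
Proof.
move=> [c1 /bounded_fun_exP[M1 b1]] [c2 /bounded_fun_exP[M2 b2]]; split.
  exact: C2DZ.
apply/bounded_fun_exP; exists (M1 + `|t| * M2) => x.
by rewrite (le_trans (ler_normD _ _)) // lerD // normrM ler_wpM2l.
Qed.

Lemma Cb2_cst (c : R) : Cb2 (fun _ : 'rV[R]_n => c).
Proof.
split; last by apply/bounded_fun_exP; exists `|c|.
split=> [y _|i y _]; first exact: differentiable_cst.
exists setT; first exact: filterT.
apply/lipschitz_exP; exists 0 => z t _ _.
by rewrite /partial !derive_cst subrr normr0 mul0r.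
Qed.

Lemma C2_continuous phi : C2 setT phi -> continuous phi.
Proof. by move=> [d _] x; exact/differentiable_continuous/d. Qed.

(** Boxes reduced to a point have volume 0 as soon as the product has a factor; for n = 0 the empty
    product would be 1. *)
Lemma lebesgue_null0 : (0 < n)%N -> lebesgue_null (set0 : set 'rV[R]_n).
Proof.
move=> n0 e e0; exists (fun=> 0), (fun=> 0); split=> //.
rewrite eseries0 ?lee_fin ?ltW // => k _ _.
by rewrite /box_volume (bigD1 (Ordinal n0)) //= subrr mul0r.
Qed.

Lemma continuous_Linfty phi : (0 < n)%N -> continuous phi -> bounded_fun phi ->
  Linfty phi.
Proof.
move=> n0 cphi /bounded_fun_exP[M bphi]; split.
  move=> c; exists [set x | c < phi x]; last first.
    by rewrite setDv setU0; exact: lebesgue_null0.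
  apply: sub_sigma_algebra.
  exact: (open_comp (fun x _ => cphi x) (@open_gt _ c)).
exists M; rewrite /ae_lebesgue (_ : [set _ | _] = set0); first exact: lebesgue_null0.
by rewrite -subset0 => x /=; exact.
Qed.

Lemma Cb2_admissible phi x d : (0 < n)%N -> Cb2 phi -> admissible x d phi.
Proof.
move=> n0 [c b]; split; first exact: C2_setT.
by apply: continuous_Linfty => //; exact: C2_continuous.
Qed.

Lemma penalty_Cb2 x : Cb2 (penalty x).
Proof.
split; last first.
  apply/bounded_fun_exP; exists n%:R => y.
  by rewrite ger0_norm ?penalty_ge0 // penalty_le.
split=> [y _|i y _]; first exact: differentiable_penalty.
exists setT; first exact: filterT.
apply/lipschitz_exP; exists 2 => z z' _ _; apply: le_trans (partial_penalty_lip _ _ _ _) _.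
by rewrite ler_pM2l //; have := le_coord_norm (z - z') i; rewrite !mxE.
Qed.

End C2.

(** * The operator at penalized test functions *)

Section operator.
Context {R : realType} {n : nat}.
Variables (Omega : set 'rV[R]_n) (I : nonlocal_operator R n).
Hypothesis n_gt0 : (0 < n)%N.
Implicit Types (phi : 'rV[R]_n -> R) (x : 'rV[R]_n).

Lemma eball_nbhs x (d : R) : 0 < d -> nbhs x (eball x d).
Proof.
move=> /(@enorm_lt R n)[e e0 ed]; apply/(@nbhs_normP R 'rV[R]_n x (eball x d)); exists e => //= y /=.
by rewrite distrC => /ed.
Qed.

(** Stability at the fixed point [x]: the penalty, its first derivatives and their Lipschitz
    constants are bounded, so the perturbations tend to 0 in the C^{1,1} norm. *)
Lemma cvg_op_penalized (hstab : op_stability Omega I) phi x (r : R) (t_ : nat -> R) :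
  Cb2 phi -> Omega x -> t_ @ \oo --> (0 : R) ->
  I x r (fun y => phi y + t_ k * penalty x y) @[k --> \oo] --> I x r phi.
Proof.
move=> Cphi Ox t0.
apply: (hstab 1 r x (fun=> x) phi (fun k y => phi y + t_ k * penalty x y)) => //.
- exact: Cb2_admissible.
- by move=> k; apply: Cb2_admissible => //; apply: Cb2DZ => //; exact: penalty_Cb2.
- exact: cvg_cst.
- rewrite /ae_lebesgue (_ : [set _ | _] = set0); first exact: lebesgue_null0.
  rewrite -subset0 => y /=; apply.
  rewrite -[X in _ --> X]addr0 -[X in phi y + X](mul0r (penalty x y)).
  by apply: cvgD; [exact: cvg_cst|apply: cvgMl].
(* The constant n + 2 dominates the three bounds at once: n for the penalty, 1 for its partial
   derivatives, 2 for their Lipschitz constant. *)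
- move=> e e0; have e'0 : 0 < e / (n.+2)%:R by rewrite divr_gt0.
  have : \forall k \near \oo, `|t_ k| < e / (n.+2)%:R.
    by move/cvgr0Pnorm_lt : t0; apply.
  apply: filterS => k tk.
  have tke (a b : R) : `|a| <= n.+2%:R * b -> 0 <= b -> `|t_ k * a| <= e * b.
    move=> ab b0; rewrite normrM (le_trans (ler_pM _ _ (ltW tk) ab)) //.
    by rewrite mulrA divfK.
  have dE i y : partial i (fun y0 => phi y0 + t_ k * penalty x y0) y - partial i phi y =
      t_ k * partial i (penalty x) y.
    rewrite partialDZ; [by rewrite addrC addKr|exact: (Cphi.1.1)|].
    exact: differentiable_penalty.
  split=> [y _|i /=]; last split=> [y _|y z _ _].
  + rewrite addrC addKr -[leRHS]mulr1 tke // mulr1 ger0_norm ?penalty_ge0 //.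
    by rewrite (le_trans (penalty_le _ _)) // ler_nat ltnW.
  + rewrite dE -[leRHS]mulr1 tke // mulr1 (le_trans (partial_penalty_le1 _ _ _)) //.
    by rewrite ler1n.
  + rewrite !dE -mulrBr tke ?sqrtr_ge0 //.
    apply: le_trans (partial_penalty_lip _ _ _ _) _.
    rewrite ler_pM ?ler_nat //.
    by have := le_coord_enorm (y - z) i; rewrite !mxE.
- have [M bphi] := (@bounded_fun_exP R _ phi).1 Cphi.2.
  have [K bt] : exists K, forall k, `|t_ k| <= K.
    apply/bounded_fun_exP; apply: cvg_seq_bounded; apply/cvg_ex; exists 0; exact: t0.
  exists (M + K * n%:R) => k y.
  rewrite (le_trans (ler_normD _ _)) // lerD // normrM ler_pM //.
  by rewrite ger0_norm ?penalty_ge0 // penalty_le.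
Qed.

(** Stability first fixes a small [e] for which the value at [x] stays in [J]; Continuity for that
    one function then yields [rho]. The sign [s] will be 1 or -1, and [J] an open half-line. *)
Lemma op_penalized_near (hstab : op_stability Omega I) (hcont : op_continuity Omega I)
    (oO : open Omega) phi x (r s : R) (J : set R) :
  Cb2 phi -> Omega x -> open J -> J (I x r phi) ->
  exists2 e : R, 0 < e &
  exists2 rho : R, 0 < rho & forall z r', Omega z -> `|z - x| < rho -> `|r' - r| < rho ->
    J (I z r' (fun y => phi y + s * e * penalty x y)).
Proof.
move=> Cphi Ox oJ Jx.
have h0 : (fun k : nat => s * k.+1%:R^-1) @ \oo --> (0 : R).
  by rewrite -[X in _ --> X](mulr0 s); apply: cvgMr; exact: cvg_harmonic.
have := (@cvg_op_penalized hstab _ _ r _ Cphi Ox h0) _ (open_nbhs_nbhs (conj oJ Jx)).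
move=> -[k _ /(_ k (leqnn k)) Jk]; exists k.+1%:R^-1; first by rewrite invr_gt0.
set Phi : 'rV[R]_n -> R := fun y => _; rewrite -/Phi in Jk.
have CPhi : Cb2 Phi by apply: Cb2DZ => //; exact: penalty_Cb2.
have := hcont 1 x Phi ltr01 Ox (Cb2_admissible x 1 n_gt0 CPhi).
move=> /(_ (x, r)) cI.
have Jn : nbhs (I x r Phi) J by exact: open_nbhs_nbhs.
(* The set on which Continuity holds is a neighbourhood of (x, r), [Omega] being open, so subspace
   continuity is ordinary continuity there. *)
have {cI} : nbhs (x, r) (fun yr : 'rV[R]_n * R => J (I yr.1 yr.2 Phi)).
  rewrite (@nbhs_subspace_interior _ ((eball x 1 `&` Omega) `*` [set: R])).
    exact: (cI _ Jn).
  exists (eball x 1 `&` Omega, setT) => //=; split; last exact: filterT.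
  by apply: filterI; [exact: eball_nbhs|exact: open_nbhs_nbhs].
move=> [[A B] [/= /(@nbhs_normP R 'rV[R]_n)[a a0 aA] /nbhs_normP[b b0 bB]] ABJ].
exists (Num.min a b); first by rewrite lt_min a0 b0.
move=> z r' Oz; rewrite !lt_min => /andP[za _] /andP[_ rb].
by apply: (ABJ (z, r')); split; [apply: aA|apply: bB]; rewrite /= distrC.
Qed.

End operator.

(** * Semicontinuous envelopes *)

Section envelope.
Context {R : realType} {n : nat}.
Implicit Types (x : 'rV[R]_n) (u : 'rV[R]_n -> R).

Lemma nbhs_closed_eball x (d : R) : 0 < d -> nbhs x (closed_eball x d).
Proof. by move=> d0; apply: filterS (eball_nbhs x d0) => y /ltW. Qed.

Lemma closed_eball_center x (d : R) : 0 <= d -> closed_eball x d x.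
Proof.
move=> d0; rewrite /closed_eball /= /enorm subrr big1 ?sqrtr0 // => i _.
by rewrite mxE expr0n.
Qed.

Lemma norm_le_enorm x : `|x| <= enorm x.
Proof.
have [x0|/mx_norm_neq0[[j i] /= x0]] := eqVneq (mx_norm x) 0.
  by rewrite [leLHS]x0 sqrtr_ge0.
by rewrite [leLHS]x0 ord1 le_coord_enorm.
Qed.

Lemma closed_eball_subset x (V : set 'rV[R]_n) : nbhs x V ->
  exists2 d : R, 0 < d & closed_eball x d `<=` V.
Proof.
move=> /(@nbhs_normP R 'rV[R]_n)[e e0 eV]; exists (e / 2); first by rewrite divr_gt0.
move=> y yx; apply: eV; rewrite /= distrC (le_lt_trans (norm_le_enorm _)) //.
by rewrite (le_lt_trans yx) // ltr_pdivrMr // ltr_pMr // ltr1n.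
Qed.

(** The supremum over a closed ball is nondecreasing in the radius, and bounded below by the value
    at the center, so its right limit at 0 is its infimum. *)
Lemma usc_envelopeE u x : bounded_fun u -> usc_envelope u x =
  inf [set sup [set u y | y in closed_eball x r] | r in [set r | 0 < r]].
Proof.
move=> /bounded_fun_exP[M uM].
have ubS r : has_ubound [set u y | y in closed_eball x r].
  by exists M => _ [y _ <-]; rewrite (le_trans (ler_norm _)).
have itvE : [set r : R | 0 < r] = [set` Interval (BRight 0) (BInfty R false)].
  by apply/seteqP; split=> r /=; rewrite in_itv /= andbT.
rewrite itvE; apply/cvg_lim => //; apply: nondecreasing_at_right_cvgr => //.
  move=> r s; rewrite !in_itv /= !andbT => r0 s0 rs; apply: ge_sup.
    by exists (u x), x => //; exact/closed_eball_center/ltW.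
  move=> _ [y yr <-]; apply: ub_le_sup => //; exists y => //.
  exact: le_trans yr rs.
exists (- M) => _ [r r0 <-]; apply: le_trans (ub_le_sup (ubS r) _); last first.
  by exists x; [move: r0; rewrite /= in_itv /= andbT => /ltW; exact: closed_eball_center|].
by have := uM x; rewrite ler_norml => /andP[].
Qed.

(** Together with [usc_envelope_le], this describes the envelope as the infimum of the upper bounds
    of [u] near [x]; later arguments then need no radii. *)
Lemma usc_envelope_lt u x (a : R) : bounded_fun u -> usc_envelope u x < a ->
  exists2 b : R, b < a & \forall y \near x, u y <= b.
Proof.
move=> bu; have /bounded_fun_exP[M uM] := bu.
rewrite usc_envelopeE // => /inf_lt[|_ [r r0 <-] ra].
  by exists (sup [set u y | y in closed_eball x 1]), 1 => /=.
exists (sup [set u y | y in closed_eball x r]) => //.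
apply: filterS (nbhs_closed_eball x r0) => y yr; apply: ub_le_sup; last by exists y.
by exists M => _ [z _ <-]; rewrite (le_trans (ler_norm _)).
Qed.

Lemma usc_envelope_le u x (b : R) : bounded_fun u ->
  (\forall y \near x, u y <= b) -> usc_envelope u x <= b.
Proof.
move=> bu /closed_eball_subset[r r0 rb]; have /bounded_fun_exP[M uM] := bu.
rewrite usc_envelopeE //; apply: le_trans (_ : sup [set u y | y in closed_eball x r] <= _).
  apply: ge_inf; last by exists r.
  exists (- M) => _ [s s0 <-].
  have := uM x; rewrite ler_norml => /andP[Mx _]; apply: le_trans Mx (ub_le_sup _ _).
    by exists M => _ [y _ <-]; rewrite (le_trans (ler_norm _)).
  by exists x => //; exact/closed_eball_center/ltW.
apply: ge_sup; first by exists (u x), x => //; exact/closed_eball_center/ltW.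
by move=> _ [y yr <-]; exact: rb.
Qed.

Lemma le_usc_envelope u x : bounded_fun u -> u x <= usc_envelope u x.
Proof.
move=> bu; rewrite leNgt; apply/negP => /(usc_envelope_lt bu)[b bx /nbhs_singleton].
by rewrite leNgt bx.
Qed.

Lemma usc_envelope_near u x (c : R) (V : set 'rV[R]_n) : bounded_fun u -> 0 < c ->
  nbhs x V -> exists2 y, V y & usc_envelope u x - c < u y.
Proof.
move=> bu c0 Vx; apply: contrapT => noy.
have : usc_envelope u x <= usc_envelope u x - c.
  apply: usc_envelope_le => //; apply: filterS Vx => y Vy.
  by rewrite leNgt; apply/negP => uy; apply: noy; exists y.
by apply/negP; rewrite -ltNge gtrBl.
Qed.

Lemma bounded_usc_envelope u : bounded_fun u -> bounded_fun (usc_envelope u).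
Proof.
move=> bu; have /bounded_fun_exP[M uM] := bu; apply/bounded_fun_exP; exists M => x.
rewrite ler_norml; apply/andP; split.
  by apply: le_trans (le_usc_envelope x bu); have := uM x; rewrite ler_norml => /andP[].
by apply: usc_envelope_le => //; apply: (@filterE _ (nbhs x)) => y; rewrite (le_trans (ler_norm _)).
Qed.

(** An upper bound of [u] near [x] is also one near every point close to [x]. *)
Lemma usc_envelope_USC u : bounded_fun u -> USC (usc_envelope u).
Proof.
move=> bu x a /(usc_envelope_lt bu)[b ba /nbhs_interior].
by apply: filterS => y yb; rewrite (le_lt_trans _ ba) // usc_envelope_le.
Qed.

(** On every small enough ball the infimum lies between u x - e, by semicontinuity, and u x. *)
Lemma lsc_envelope_id u : bounded_fun u -> LSC u -> lsc_envelope u = u.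
Proof.
move=> /bounded_fun_exP[M uM] lu; apply/funext => x.
apply/cvg_lim => //; apply/cvgrPdist_le => e e0.
have [|V Vx Vu] := lu x (u x - e); first by rewrite lte_fin gtrBl.
have [d d0 dV] := closed_eball_subset Vx.
near=> r.
have r0 : 0 < r by near: r; exact: nbhs_right_gt.
have rd : r < d by near: r; exact: nbhs_right_lt.
have ux : [set u y | y in closed_eball x r] (u x).
  by exists x => //; exact/closed_eball_center/ltW.
rewrite ger0_norm; last first.
  rewrite subr_ge0; apply: ge_inf => //.
  by exists (- M) => _ [y _ <-]; have := uM y; rewrite ler_norml => /andP[].
rewrite lerBlDr -lerBlDl; apply: lb_le_inf; first by exists (u x).
move=> _ [y yr <-]; apply: ltW; rewrite -lte_fin; apply/Vu/dV.
exact: le_trans yr (ltW rd).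
Unshelve. all: by end_near.
Qed.

End envelope.

(** * The upper envelope of a supremum of subsolutions *)

Lemma continuous_dist (R : realType) (V : normedModType R) (x : V) :
  continuous (fun y : V => `|y - x|).
Proof. by move=> y; apply: cvg_norm; apply: cvgB; [exact: cvg_id|exact: cvg_cst]. Qed.

Section perron.
Context {R : realType} {n : nat}.
Variables (Omega : set 'rV[R]_n) (I : nonlocal_operator R n).
Implicit Types (x : 'rV[R]_n) (u v w phi : 'rV[R]_n -> R) (F : set ('rV[R]_n -> R)).

Lemma compact_normball x (r : R) : compact [set y : 'rV[R]_n | `|y - x| <= r].
Proof.
apply: bounded_closed_compact.
  exists (r + `|x|); split; first exact: num_real.
  move=> M rM y /= yr; rewrite -(subrK x y) (le_trans (ler_normD _ _)) //.
  by rewrite (le_trans _ (ltW rM)) // lerD2r.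
by apply: (closed_comp _ (@closed_le _ r)) => y _; exact: continuous_dist.
Qed.

Lemma continuous_near_lt phi x (c : R) : continuous phi -> 0 < c ->
  \forall y \near x, `|phi y - phi x| < c.
Proof.
move=> cphi c0; have /cvgrPdist_lt/(_ _ c0) := cphi x.
by apply: filterS => y; rewrite distrC.
Qed.

(** The gain [m] away from the center is what localizes the extrema of penalized functions. *)
Lemma penalty_gap (e r : R) : 0 < e -> 0 < r ->
  exists2 m : R, 0 < m & forall x y, r <= `|y - x| -> m <= e * penalty x y.
Proof.
move=> e0 r0; exists (e * (1 - (1 + r ^+ 2)^-1)).
  rewrite mulr_gt0 // subr_gt0 invf_lt1 ?ltrDl ?exprn_gt0 //.
  by rewrite ltr_wpDr // sqr_ge0.
by move=> x y ry; rewrite ler_pM2l // le_penalty.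
Qed.

(** A test function touching the maximum from above at a point touches there whichever of [u], [v]
    is the larger. *)
Lemma viscosity_subsolution_max u v : viscosity_subsolution Omega I u ->
  viscosity_subsolution Omega I v ->
  viscosity_subsolution Omega I (fun x => Num.max (u x) (v x)).
Proof.
move=> [/bounded_fun_exP[M1 b1] cu su] [/bounded_fun_exP[M2 b2] cv sv]; split.
- apply/bounded_fun_exP; exists (Num.max M1 M2) => x.
  rewrite le_max /Num.max; case: ifP => _; first by rewrite b2 orbT.
  by rewrite b1.
- move=> x a; rewrite gt_max => /andP[ua va].
  near=> y; rewrite gt_max; apply/andP; split; near: y; [exact: cu|exact: cv].
- move=> phi x Cphi Ox; have [vu|/ltW uv] := leP (v x) (u x) => h.
    apply: su => // y; apply: le_trans (h y).
    by rewrite lerD2r le_max lexx.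
  apply: sv => // y; apply: le_trans (h y).
  by rewrite lerD2r le_max lexx orbT.
Unshelve. all: by end_near.
Qed.

Hypothesis n_gt0 : (0 < n)%N.
Hypothesis hcont : op_continuity Omega I.
Hypothesis hstab : op_stability Omega I.
Hypothesis openO : open Omega.

Lemma subsolution_usc_envelope F w : bounded_fun w ->
  (forall u, F u -> continuous u /\ viscosity_subsolution Omega I u) ->
  (forall u x, F u -> u x <= w x) ->
  (forall x (a : R), a < w x -> exists2 u, F u & a < u x) ->
  viscosity_subsolution Omega I (usc_envelope w).
Proof.
move=> bw Fs Fw wF; split; [exact: bounded_usc_envelope|exact: usc_envelope_USC|].
move=> phi x Cphi Ox hmax; rewrite leNgt; apply/negP => Ipos.
set W := usc_envelope w in hmax Ipos *.
have [e e0 [rho rho0]] := op_penalized_near n_gt0 hstab hcont openO 1 Cphi Ox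
  (@open_gt R 0) Ipos.
rewrite mul1r; set Phi := fun y : 'rV[R]_n => phi y + e * penalty x y => Inear.
have CPhi : Cb2 Phi by apply: Cb2DZ => //; exact: penalty_Cb2.
have cPhi := C2_continuous CPhi.1.
have Phix : Phi x = phi x by rewrite /Phi penalty_self mulr0 addr0.
(* This bound will keep u y0 below W x + rho at the maximum point y0 found later. *)
have [b bW wb] : exists2 b, b < W x + rho & \forall y \near x, w y <= b.
  by apply: usc_envelope_lt => //; rewrite ltrDl.
have rho4 : 0 < rho / 4 by rewrite divr_gt0.
have : \forall y \near x, [/\ Omega y, w y <= b & `|Phi y - Phi x| < rho / 4].
  near=> y; split; near: y => //; last exact: continuous_near_lt.
  exact: open_nbhs_nbhs.
move=> /(@nbhs_normP R 'rV[R]_n)[r1 /= r10 xr1].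
have [r [r0 rr1 rrho]] : exists r, [/\ 0 < r, r < r1 & r < rho].
  exists (Num.min r1 rho / 2); have m0 : 0 < Num.min r1 rho by rewrite lt_min r10.
  have lt2 : Num.min r1 rho / 2 < Num.min r1 rho by rewrite ltr_pdivrMr // ltr_pMr // ltr1n.
  by move: (lt2); rewrite lt_min => /andP[? ?]; split=> //; rewrite divr_gt0.
have [m m0 hm] := penalty_gap e0 r0.
(* Two errors of size [c] occur, in u x' and in Phi x'. Their sum must stay below [m], to localize
   the maximum, and below rho / 2, to keep u y0 above W x - rho. *)
pose c := Num.min m rho / 4.
have c0 : 0 < c by rewrite divr_gt0 // lt_min m0.
have cm : c * 4 <= m by rewrite divfK // ge_min lexx.
have crho : c * 4 <= rho by rewrite divfK // ge_min lexx orbT.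
have [x' [x'r Phix'] wx'] : exists2 y, `|y - x| <= r /\ `|Phi y - Phi x| < c & W x - c < w y.
  apply: usc_envelope_near => //; near=> y; split.
    near: y; apply/(@nbhs_normP R 'rV[R]_n); exists r => //= y /=.
    by rewrite distrC => /ltW.
  by near: y; exact: continuous_near_lt.
have [u Fu ux'] := wF _ _ wx'.
have [cu [_ _ su]] := Fs _ Fu.
have [y0 y0r y0max] : exists2 y0, y0 \in [set y : 'rV[R]_n | `|y - x| <= r] &
    forall t, t \in [set y : 'rV[R]_n | `|y - x| <= r] -> u t - Phi t <= u y0 - Phi y0.
  apply: EVT_max_rV; [by exists x'|exact: compact_normball|].
  apply: continuous_subspaceT => y.
  exact: (continuousB (cu y) (cPhi y)).
rewrite inE /= in y0r.
have x'y0 : u x' - Phi x' <= u y0 - Phi y0 by apply: y0max; rewrite inE.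
move: Phix'; rewrite ltr_norml => /andP[Phix'l Phix'u].
have [|Oy0 wy0] := xr1 y0; first by rewrite /= distrC (le_lt_trans y0r).
rewrite ltr_norml => /andP[Phiy0l Phiy0u].
(* The maximum on the ball is global: outside, u - Phi is at most W x - phi x - m, while at x' it
   exceeds W x - phi x - 2 c. *)
have Iy0 : I y0 (u y0) Phi <= 0.
  apply: su => // y; have [yr|/ltW yr] := leP `|y - x| r.
    by apply: y0max; rewrite inE.
  apply: le_trans x'y0; have := hm _ _ yr; have := hmax y.
  have : u y <= W y by apply: le_trans (Fw _ y Fu) (le_usc_envelope _ bw).
  by rewrite {1}/Phi; lra.
have uw := Fw u y0 Fu.
suff : 0 < I y0 (u y0) Phi by rewrite ltNge Iy0.
apply: Inear => //; first exact: le_lt_trans y0r rrho.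
by rewrite ltr_norml; apply/andP; split; lra.
Unshelve. all: by end_near.
Qed.

End perron.

(** * The Perron family and its supremum *)

Section perron_sup.
Context {R : realType} {n : nat}.
Variables (Omega : set 'rV[R]_n) (I : nonlocal_operator R n).
Variables (ul ub : 'rV[R]_n -> R).
Implicit Types (x y z : 'rV[R]_n) (u v phi Phi : 'rV[R]_n -> R).
Hypothesis ul_cont : continuous ul.
Hypothesis ul_sub : viscosity_subsolution Omega I ul.
Hypothesis le_ul_ub : forall x, ul x <= ub x.

Local Notation F := (perron_family Omega I ul ub).
Local Notation w := (perron_sup Omega I ul ub).

Lemma perron_family_ul : F ul.
Proof. by split=> // x; rewrite lexx le_ul_ub. Qed.

Lemma le_perron_sup u x : F u -> u x <= w x.
Proof.
move=> Fu; apply: ub_le_sup; last by exists u.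
by exists (ub x) => _ [v [_ /(_ x)/andP[_ vub] _] <-].
Qed.

Lemma perron_sup_le x : w x <= ub x.
Proof.
apply: ge_sup; first by exists (ul x), ul => //; exact: perron_family_ul.
by move=> _ [v [_ /(_ x)/andP[_ vub] _] <-].
Qed.

Lemma perron_sup_gt x (a : R) : a < w x -> exists2 u, F u & a < u x.
Proof.
move=> /sup_gt[|_ [u Fu <-] au]; last by exists u.
by exists (ul x), ul => //; exact: perron_family_ul.
Qed.

Lemma bounded_perron_sup : bounded_fun ul -> bounded_fun ub -> bounded_fun w.
Proof.
move=> /bounded_fun_exP[M1 b1] /bounded_fun_exP[M2 b2].
apply/bounded_fun_exP; exists (Num.max M1 M2) => x.
have l1 := le_perron_sup x perron_family_ul; have l2 := perron_sup_le x.
move: (b1 x) (b2 x); rewrite !ler_norml => /andP[h1 _] /andP[_ h2].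
apply/andP; split; last by rewrite (le_trans l2) // le_max h2 orbT.
by rewrite lerNl le_max [_ <= M1]lerNl (le_trans h1).
Qed.

Lemma perron_sup_LSC : LSC w.
Proof.
move=> x a; rewrite lte_fin => /perron_sup_gt[u Fu au].
have [cu _ _] := Fu.
have u0 : 0 < u x - a by rewrite subr_gt0.
exists [set y | `|u y - u x| < u x - a]; first exact: continuous_near_lt.
move=> y /=; rewrite ltr_norml => /andP[h _]; rewrite lte_fin.
by apply: lt_le_trans (le_perron_sup y Fu); lra.
Qed.

Lemma perron_family_max u v : F u -> F v -> F (fun x => Num.max (u x) (v x)).
Proof.
move=> [cu bu su] [cv bv sv]; split.
- by move=> x; apply: continuous_max; [exact: cu|exact: cv].
- move=> x; have /andP[u1 u2] := bu x; have /andP[v1 v2] := bv x.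
  by rewrite le_max ge_max u1 u2 v2.
- exact: viscosity_subsolution_max.
Qed.

(* Compactness replaces the supremum by a single member of the family, which *)
(* stays continuous when it is later modified near a point.                  *)
Lemma perron_family_gt (h : 'rV[R]_n -> R) : bounded_set Omega -> continuous h ->
  (forall y, h y < w y) -> (forall y, ~ Omega y -> h y < ul y) ->
  exists2 u, F u & forall y, h y < u y.
Proof.
move=> /pinfty_ex_gt0[M _ OM] ch hw hul.
have /choice[U hU] : forall y, exists u, F u /\ h y < u y.
  by move=> y; have [u Fu hu] := perron_sup_gt (hw y); exists u.
(* This ball contains [Omega], and finitely many of the open sets where a chosen member exceeds [h]
   cover it; the maximum of those members works. Off [Omega] every member is above [ul], hence above
   [h]. *)
have := @compact_normball R n 0 M; rewrite compact_cover.
move=> /(_ _ setT (fun y => [set z | 0 < U y z - h z])) [].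
- move=> y _; apply: (open_comp _ (@open_gt _ 0)) => z _.
  by have [[cU _ _] _] := hU y; exact: (continuousB (cU z) (ch z)).
- by move=> y _; exists y => //=; rewrite subr_gt0; have [] := hU y.
move=> D _ KD.
have [u Fu uD] : exists2 u, F u &
    forall y, y \in finmap.enum_fset D -> forall z, U y z <= u z.
  elim: (finmap.enum_fset D) => [|y s [u Fu us]].
    by exists ul => //; exact: perron_family_ul.
  exists (fun x => Num.max (U y x) (u x)).
    by apply: perron_family_max => //; have [] := hU y.
  move=> z; rewrite inE => /predU1P[->|zs] t; rewrite le_max ?lexx //.
  by rewrite us ?orbT.
exists u => // y; have [Oy|nOy] := pselect (Omega y); last first.
  have [_ /(_ y)/andP[ulu _] _] := Fu.
  exact: lt_le_trans (hul _ nOy) ulu.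
have [|z zD] := KD y; first by rewrite /= subr0; exact: OM.
by rewrite /= subr_gt0 => /lt_le_trans; apply; exact: uD.
Qed.

(** [Phi] can exceed [u] only at distance less than [r] from [x], so the upper bound and the
    subsolution inequality for [Phi] matter only there. A test function touching the maximum where
    [Phi] is larger also touches [Phi]. *)
Lemma perron_family_bump u Phi x (r : R) : F u -> continuous Phi -> bounded_fun Phi ->
  (forall y, r <= `|y - x| -> Phi y <= u y) ->
  (forall y, `|y - x| < r -> Phi y <= ub y) ->
  (forall phi z, Cb2 phi -> Omega z -> `|z - x| < r ->
     (forall y, Phi y - phi y <= Phi z - phi z) -> I z (Phi z) phi <= 0) ->
  F (fun y => Num.max (u y) (Phi y)).
Proof.
move=> [cu bu [bfu uu su]] cPhi bPhi Phiu Phiub sPhi.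
have cU : continuous (fun y => Num.max (u y) (Phi y)).
  by move=> y; apply: continuous_max; [exact: cu|exact: cPhi].
split=> //.
- move=> y; have /andP[u1 u2] := bu y.
  rewrite le_max ge_max u1 u2 /=; have [yr|/Phiub //] := leP r `|y - x|.
  exact: le_trans (Phiu _ yr) u2.
- split.
  + have /bounded_fun_exP[M1 b1] := bfu; have /bounded_fun_exP[M2 b2] := bPhi.
    apply/bounded_fun_exP; exists (Num.max M1 M2) => y.
    rewrite le_max /Num.max; case: ifP => _; first by rewrite b2 orbT.
    by rewrite b1.
  + move=> y a Ua; have c0 : 0 < a - Num.max (u y) (Phi y) by rewrite subr_gt0.
    apply: filterS (continuous_near_lt y cU c0) => z.
    by rewrite ltr_norml => /andP[_]; rewrite ltrD2r.
  + move=> phi z Cphi Oz; have [Pu|uP] := leP (Phi z) (u z) => h.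
      apply: su => // y; apply: le_trans (h y).
      by rewrite lerD2r le_max lexx.
    have zr : `|z - x| < r by rewrite ltNge; apply/negP => /Phiu; rewrite leNgt uP.
    apply: sPhi => // y; apply: le_trans (h y).
    by rewrite lerD2r le_max lexx orbT.
Qed.

(** * The Perron supremum is a supersolution *)

Hypothesis n_gt0 : (0 < n)%N.
Hypothesis hcont : op_continuity Omega I.
Hypothesis hstab : op_stability Omega I.
Hypothesis hinv : op_invariance Omega I.
Hypothesis hell : op_degenerate_ellipticity Omega I.
Hypothesis openO : open Omega.
Hypothesis bndO : bounded_set Omega.
Hypothesis ul_bnd : bounded_fun ul.
Hypothesis ub_bnd : bounded_fun ub.
Hypothesis ub_cont : continuous ub.
Hypothesis ub_super : viscosity_supersolution Omega I ub.
Hypothesis ul_ub_out : forall x, ~ Omega x -> ul x = ub x.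

Lemma perron_sup_supersolution : viscosity_supersolution Omega I w.
Proof.
split; [exact: bounded_perron_sup|exact: perron_sup_LSC|].
move=> phi x Cphi Ox hmin.
(* If w x = ub x, then [phi] touches [ub] from below as well, because w <= ub, and the supersolution
   property of [ub] applies. *)
have := perron_sup_le x; rewrite le_eqVlt => /predU1P[wub|wub].
  have [_ _ sub] := ub_super.
  rewrite wub in hmin *; apply: sub => // y; apply: le_trans (hmin y) _.
  by rewrite lerD2r perron_sup_le.
rewrite leNgt; apply/negP => Ineg.
have [e e0 [rho rho0 Inear]] := op_penalized_near n_gt0 hstab hcont openO (-1) Cphi Ox
  (@open_lt R 0) Ineg.
set Psi := fun y : 'rV[R]_n => phi y + -1 * e * penalty x y in Inear.
have CPsi : Cb2 Psi by apply: Cb2DZ => //; exact: penalty_Cb2.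
have cPsi := C2_continuous CPsi.1.
have cphi := C2_continuous Cphi.1.
have Psix : Psi x = phi x by rewrite /Psi penalty_self mulr0 addr0.
pose g := ub x - w x; have g0 : 0 < g by rewrite subr_gt0.
have rho2 : 0 < rho / 2 by rewrite divr_gt0.
have g4 : 0 < g / 4 by rewrite divr_gt0.
have : \forall y \near x, [/\ `|Psi y - Psi x| < rho / 2, `|Psi y - Psi x| < g / 4
    & `|ub y - ub x| < g / 4].
  by near=> y; split; near: y; exact: continuous_near_lt.
move=> /(@nbhs_normP R 'rV[R]_n)[r1 /= r10 xr1].
pose r := Num.min r1 rho; have r0 : 0 < r by rewrite lt_min r10.
have [m m0 hm] := @penalty_gap R n _ _ e0 r0.
(* The three bounds on the lift [kap] keep [Phi] below [u] outside the ball ([m]), its values within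
   [rho] of w x inside ([rho]), and [Phi] below [ub] inside ([g]). *)
pose kap := Num.min m (Num.min rho g) / 2.
have kap0 : 0 < kap by rewrite divr_gt0 // !lt_min m0 rho0.
have [kapm kaprho kapg] : [/\ kap <= m / 2, kap <= rho / 2 & kap <= g / 2].
  by split; rewrite ler_pM2r ?invr_gt0 // !ge_min lexx ?orbT.
pose k := w x - phi x.
have phiw y : phi y + k <= w y by have := hmin y; rewrite /k; lra.
(* The slack m / 2 gives strict inequality with [w]; outside the ball the penalty loss [m] covers
   both this slack and the lift [kap]. *)
have [u Fu hu] : exists2 u, F u & forall y, phi y + (k - m / 2) < u y.
  apply: perron_family_gt => //.
  - by move=> y; exact: (continuousD (cphi y) (@cst_continuous _ _ _ y)).
  - by move=> y; apply: lt_le_trans (phiw y); lra.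
  - move=> y nOy; apply: (@lt_le_trans _ _ (w y)).
      by apply: lt_le_trans (phiw y); lra.
    by rewrite ul_ub_out // perron_sup_le.
pose Phi y := Psi y + (k + kap).
have xr y : `|y - x| < r -> [/\ `|Psi y - Psi x| < rho / 2, `|Psi y - Psi x| < g / 4
    & `|ub y - ub x| < g / 4].
  by rewrite lt_min => /andP[yr _]; apply: xr1; rewrite /= distrC.
have : F (fun y => Num.max (u y) (Phi y)).
  apply: (@perron_family_bump u Phi x r) => //.
  - by move=> y; exact: (continuousD (cPsi y) (@cst_continuous _ _ _ y)).
  - have /bounded_fun_exP[M bM] := CPsi.2.
    apply/bounded_fun_exP; exists (M + `|k + kap|) => y.
    by rewrite (le_trans (ler_normD _ _)) // lerD2r.
  - by move=> y /hm; have := hu y; rewrite /Phi /Psi; lra.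
  - move=> y yr; have [_ + +] := xr y yr; rewrite !ltr_norml => /andP[_ h1] /andP[h2 _].
    by move: h1 h2 kapg; rewrite /Phi /g /k Psix; lra.
  (* Since [Phi] and [Psi] differ by a constant, chi + C touches [Psi] from above at [z].
     Ellipticity bounds its operator value by the negative one of [Psi], and Invariance removes
     [C]. *)
  - move=> chi z Cchi Oz zr hmax.
    pose C := Psi z - chi z.
    rewrite -(hinv (Phi z) C ltr01 Oz (Cb2_admissible _ _ n_gt0 Cchi)).
    have CchiC : Cb2 (fun y => chi y + C).
      have -> : (fun y => chi y + C) = (fun y => chi y + 1 * (fun _ : 'rV[R]_n => C) y).
        by apply/funext => y; rewrite mul1r.
      by apply: Cb2DZ => //; exact: Cb2_cst.
    have := hell (Phi z) ltr01 Oz (Cb2_admissible z 1 n_gt0 CchiC)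
      (Cb2_admissible z 1 n_gt0 CPsi).
    move=> /(_ _ _)/le_trans; apply.
    + by move=> y; have := hmax y; rewrite /Phi /C; lra.
    + by rewrite /C; lra.
    + apply/ltW/Inear => //; first by move: zr; rewrite lt_min => /andP[].
      have [+ _ _] := xr _ zr; rewrite !ltr_norml => /andP[h1 h2].
      by apply/andP; split; move: h1 h2 kaprho; rewrite /Phi /k Psix; lra.
move=> /(le_perron_sup x); rewrite ge_max => /andP[_].
by rewrite /Phi Psix /k; lra.
Unshelve. all: by end_near.
Qed.

End perron_sup.

(** * Boundary values and conclusion *)

Theorem theorem3p2 (R : realType) (n : nat) (hn : (0 < n)%N)
  (Omega : set 'rV[R]_n) (hdom : is_domain Omega) (hbnd : bounded_set Omega)
  (I : nonlocal_operator R n)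
  (hcont : op_continuity Omega I)
  (hstab : op_stability Omega I)
  (hmono : op_monotonicity Omega I)
  (hinv : op_invariance Omega I)
  (hell : op_degenerate_ellipticity Omega I)
  (ul ub g : 'rV[R]_n -> R)
  (ul_bnd : bounded_fun ul) (ul_cont : continuous ul)
  (ub_bnd : bounded_fun ub) (ub_cont : continuous ub)
  (g_bnd : bounded_fun g) (g_cont : continuous g)
  (ul_sub : viscosity_subsolution Omega I ul)
  (ub_super : viscosity_supersolution Omega I ub)
  (hg : forall x, ~ Omega x -> ub x = g x /\ ul x = g x)
  (hle : forall x, ul x <= ub x) :
  discontinuous_viscosity_solution Omega I g (perron_sup Omega I ul ub).
Proof.
have [openO _ _] := hdom.
have hout x : ~ Omega x -> ul x = ub x by move=> /hg[-> ->].
have bw : bounded_fun (perron_sup Omega I ul ub) by exact: bounded_perron_sup.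
split=> //.
- split; last first.
    (* The envelope at [x] also sees nearby points of [Omega]; there [w] is controlled by [ub],
       which is continuous and equals [g] at [x]. *)
    move=> x nOx; have [ubx _] := hg _ nOx; apply/ler_addgt0Pr => e e0.
    apply: usc_envelope_le => //; apply: filterS (continuous_near_lt x ub_cont e0) => y.
    have := perron_sup_le ul_cont ul_sub hle y.
    by rewrite ltr_norml => wub /andP[_ h]; rewrite -ubx; lra.
  apply: (@subsolution_usc_envelope _ _ _ _ hn hcont hstab openO
      (perron_family Omega I ul ub)) => //.
  + by move=> u [].
  + by move=> u x; exact: le_perron_sup.
  + by move=> x a; exact: perron_sup_gt.
- rewrite lsc_envelope_id //; last exact: perron_sup_LSC.
  split; first exact: perron_sup_supersolution.
  move=> x nOx; have [_ <-] := hg _ nOx.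
  exact/le_perron_sup/perron_family_ul.
Qed.
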